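(* Let $p>2$ be a prime, and let $r$, $s$, $t$ be any positive integers. Then $$\sum_{m_1=0}^{rp-1}\sum_{m_2=0}^{sp-1}\sum_{m_3=0}^{tp-1}\binom{m_1+m_2+m_3}{m_1,m_2,m_3}^2\equiv \sum_{m_1=0}^{r-1}\sum_{m_2=0}^{s-1}\sum_{m_3=0}^{t-1}\binom{m_1+m_2+m_3}{m_1,m_2,m_3}^2\pmod{p^2}.$$
   Context: For non-negative integers $m_1,m_2,m_3$, $\binom{m_1+m_2+m_3}{m_1,m_2,m_3}=\frac{(m_1+m_2+m_3)!}{m_1!\,m_2!\,m_3!}$ is the multinomial coefficient. *)

(* Defs.v *)
From mathcomp Require Import all_boot.

Set Implicit Arguments.
Unset Strict Implicit.
Unset Printing Implicit Defensive.

(* The truncated quotient %/ is exact here. *)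
Definition trinomial (m1 m2 m3 : nat) : nat :=
  (m1 + m2 + m3)`! %/ (m1`! * m2`! * m3`!).

(* Main.v *)
Require Import Defs.
From mathcomp Require Import all_boot all_algebra.
From mathcomp Require Import ring zify.

Set Implicit Arguments.
Unset Strict Implicit.
Unset Printing Implicit Defensive.

Import GRing.Theory.

(** Write each index in base p as m_i = a_i p + b_i with b_i < p, and put
    A = a1 + a2 + a3, B = b1 + b2 + b3. It suffices to show that, for every
    fixed (a1, a2, a3), the sum of the squared trinomials over the p^3 digit
    triples (b1, b2, b3) is congruent modulo p^2 to the square of the trinomial
    of (a1, a2, a3) ([sum_trinomial_box]).

    If p <= B, then p divides the trinomial ([dvdn_trinomial]) and its square
    vanishes modulo p^2. If B < p, removing the factors p from the factorials
    gives, with T the trinomial and H_k the harmonic numbers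
    ([trinomial_block]),
      T(a p + b) = T(a) T(b) (1 + p (sum_i a_i (H_B - H_(b_i)))) mod p^2.
    Squaring and summing over b leaves two facts to prove.

    First, the sum of T(b)^2 (H_B - H_(b_1)) vanishes modulo p, already when b2
    and b3 are fixed ([sum_trinomial_harm]). Indeed, up to sign,
    T(b) = 1 / (b0! b1! b2! b3!) modulo p, where b0 = p - 1 - B, and H_B = H_(b0)
    modulo p, so the summand changes sign when b0 and b1 are exchanged.

    Second, the sum of T(b)^2 is 1 modulo p^2 ([sum_trinomial_box1]). Grouping
    the triples by k = b1 + b2 turns it into the sum over k < p of
      G k = 'C(2k, k) * sum_(n < p) 'C(n, k)^2.
    A summation by telescoping over n ([sum_bin_sqr_rec]) gives
    (2k + 1) G k = p modulo p^2, hence G k + G (p - 1 - k) = 0 unless 2k + 1 = p.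
    For the middle index h = (p - 1) / 2, one uses that d = 'C(h + j, h) and
    c = (-1)^j 'C(h, j) agree modulo p, so d^2 = 2 c d - c^2 modulo p^2; both
    sums on the right have closed forms, and G h = 1 follows ([gsum_mid]). *)

(** * Trinomials in base p *)

Section Trinomials.

Lemma trinomial_bin m1 m2 m3 :
  trinomial m1 m2 m3 = 'C(m3 + (m1 + m2), m1 + m2) * 'C(m1 + m2, m1).
Proof.
have e1 := bin_fact (leq_addl m3 (m1 + m2)); rewrite addnK in e1.
have e2 := bin_fact (leq_addr m2 m1); rewrite addKn in e2.
rewrite /trinomial addnC -e1 -e2.
have -> : forall u v x y z, u * (v * (x * y) * z) = u * v * (x * y * z).
  by move=> *; ring.
by rewrite mulnK // !muln_gt0 !fact_gt0.
Qed.

Lemma trinomialK m1 m2 m3 :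
  trinomial m1 m2 m3 * (m1`! * m2`! * m3`!) = (m1 + m2 + m3)`!.
Proof.
rewrite trinomial_bin.
have e1 := bin_fact (leq_addl m3 (m1 + m2)); rewrite addnK in e1.
have e2 := bin_fact (leq_addr m2 m1); rewrite addKn in e2.
by rewrite [m1 + m2 + m3]addnC -e1 -e2; ring.
Qed.

Lemma trinomialC12 m1 m2 m3 : trinomial m1 m2 m3 = trinomial m2 m1 m3.
Proof. by rewrite /trinomial [m1 + m2]addnC [m1`! * m2`!]mulnC. Qed.

Lemma trinomialC13 m1 m2 m3 : trinomial m1 m2 m3 = trinomial m3 m2 m1.
Proof.
by rewrite /trinomial; congr (_`! %/ _); ring.
Qed.

Lemma fact_addn m b : (m + b)`! = m`! * \prod_(1 <= j < b.+1) (m + j).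
Proof.
elim: b => [|b IH]; first by rewrite addn0 big_geq // muln1.
by rewrite big_nat_recr //= mulnA -IH addnS factS mulnC.
Qed.

(** The product of the integers from 1 to a p + b that are not among p, 2p, ...,
    a p, in blocks of p - 1 factors; for p prime and b < p, these are the integers
    prime to p. *)
Definition pfree p a b :=
  (\prod_(0 <= i < a) \prod_(1 <= j < p) (i * p + j))
  * \prod_(1 <= j < b.+1) (a * p + j).

Lemma fact_pfree p a b : 0 < p -> (a * p + b)`! = a`! * p ^ a * pfree p a b.
Proof.
move=> p_gt0; rewrite fact_addn /pfree mulnA; congr (_ * _).
elim: a => [|a IH]; first by rewrite mul0n big_geq.
have -> : (a.+1 * p = (a * p + p.-1).+1) by nia.
rewrite factS fact_addn prednK // IH big_nat_recr //= factS expnS.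
have -> : ((a * p + p.-1).+1 = a.+1 * p) by nia.
by ring.
Qed.

Lemma coprime_pfree p a b : prime p -> b < p -> coprime p (pfree p a b).
Proof.
move=> p_pr lt_bp.
have cop i n : n <= p -> coprime p (\prod_(1 <= j < n) (i * p + j)).
  move=> le_np; rewrite big_nat; elim/big_ind: _ => [|x y cx cy|j /andP[j0 jn]].
  - exact: coprimen1.
  - by rewrite coprimeMr cx.
  rewrite /coprime gcdnMDl -/(coprime p j) prime_coprime //.
  by apply/negP => /(dvdn_leq j0); rewrite leqNgt (leq_trans jn).
rewrite coprimeMr cop // andbT; elim/big_ind: _ => [|x y cx cy|i _].
- exact: coprimen1.
- by rewrite coprimeMr cx.
exact: cop.
Qed.

(** The factors p cancel exactly, whether or not the digits b_i carry. *)
Lemma trinomial_pfree p a1 a2 a3 b1 b2 b3 : 0 < p ->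
  trinomial (a1 * p + b1) (a2 * p + b2) (a3 * p + b3)
    * (pfree p a1 b1 * pfree p a2 b2 * pfree p a3 b3)
  = trinomial a1 a2 a3 * pfree p (a1 + a2 + a3) (b1 + b2 + b3).
Proof.
move=> p_gt0.
have pos : 0 < a1`! * a2`! * a3`! * p ^ (a1 + a2 + a3).
  by rewrite !muln_gt0 !fact_gt0 expn_gt0 p_gt0.
apply/eqP; rewrite -(eqn_pmul2r pos); apply/eqP.
have e1 := trinomialK (a1 * p + b1) (a2 * p + b2) (a3 * p + b3).
have e2 : a1 * p + b1 + (a2 * p + b2) + (a3 * p + b3)
  = (a1 + a2 + a3) * p + (b1 + b2 + b3) by ring.
rewrite {}e2 !fact_pfree // -(trinomialK a1 a2 a3) in e1.
transitivity (trinomial a1 a2 a3 * (a1`! * a2`! * a3`!) *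
     p ^ (a1 + a2 + a3) * pfree p (a1 + a2 + a3) (b1 + b2 + b3)); last by ring.
by rewrite -e1 !expnD; ring.
Qed.

(** The case in which the last base-p digits carry. *)
Lemma dvdn_trinomial p a1 a2 a3 b1 b2 b3 :
  prime p -> b1 < p -> b2 < p -> b3 < p -> p <= b1 + b2 + b3 ->
  p %| trinomial (a1 * p + b1) (a2 * p + b2) (a3 * p + b3).
Proof.
move=> p_pr lt1 lt2 lt3 le_pB.
have cop : coprime p (pfree p a1 b1 * pfree p a2 b2 * pfree p a3 b3).
  by rewrite 2!coprimeMr !coprime_pfree.
rewrite -(Gauss_dvdl _ cop) trinomial_pfree ?prime_gt0 // dvdn_mull //.
(* As p <= b1 + b2 + b3, the last product of pfree has the factor A p + p. *)
rewrite /pfree dvdn_mull // (@big_cat_nat _ _ _ p) ?prime_gt0 //=; last exact: leqW.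
by rewrite dvdn_mull // big_ltn ?ltnS // dvdn_mulr // dvdn_addr ?dvdn_mull.
Qed.

End Trinomials.

(** * Sums of binomial coefficients *)

Lemma central_bin_rec k :
  (k.+1 * 'C(k.+1.*2, k.+1) = 2 * k.*2.+1 * 'C(k.*2, k))%N.
Proof.
have := mul_bin_diag k.*2.+1 k; have := mul_bin_down k.*2.+1 k.
rewrite doubleS /= (binS k.*2.+1 k).
have -> : ('C(k.*2.+1, k.+1) = 'C(k.*2.+1, k)).
  by rewrite -bin_sub; [congr 'C(_, _) |]; lia.
by have -> : (k.*2.+1 - k = k.+1)%N; [lia | nia].
Qed.

Lemma sum_bin_sqr n : (\sum_(0 <= j < n.+1) 'C(n, j) ^ 2 = 'C(n.*2, n))%N.
Proof.
rewrite -addnn -binomial.Vandermonde big_mkord; apply: eq_bigr => i _.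
by rewrite bin_sub ?mulnn // -ltnS.
Qed.

Section SumsInRings.
Local Open Scope ring_scope.

Lemma sum_nat_block (V : nmodType) (f : nat -> V) n p :
  \sum_(0 <= i < n * p) f i
  = \sum_(0 <= a < n) \sum_(0 <= b < p) f (a * p + b)%N.
Proof.
elim: n => [|n IH]; first by rewrite mul0n !big_geq.
rewrite big_nat_recr //= -IH mulSnr (@big_cat_nat _ _ _ (n * p)) ?leq_addr //=.
congr (_ + _); rewrite -{1}[(n * p)%N]add0n big_addn addKn.
by apply: eq_bigr => b _; rewrite addnC.
Qed.

(** Shifting the index of a sequence supported in the interval [c, N[. *)
Lemma sum_nat_shift (V : nmodType) (f : nat -> V) c N :
  (forall k, (k < c)%N -> f k = 0) -> (forall k, (N <= k)%N -> f k = 0) ->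
  \sum_(0 <= i < N) f (i + c)%N = \sum_(0 <= k < N) f k.
Proof.
move=> f_lt f_ge.
transitivity (\sum_(c <= i < N + c) f i).
  by rewrite -{2}[c]add0n big_addn addnK.
have -> : \sum_(c <= i < N + c) f i = \sum_(0 <= i < N + c) f i.
  rewrite [RHS](@big_cat_nat _ _ _ c) ?leq_addl //= [X in _ = X + _]big_nat.
  by rewrite [X in _ = X + _]big1 ?add0r // => i; apply: f_lt.
rewrite (@big_cat_nat _ _ _ N) ?leq_addr //= [X in _ + X]big_nat.
by rewrite [X in _ + X]big1 ?addr0 // => i /andP[/f_ge].
Qed.

Lemma natr_mul_bin_left (R : comNzRingType) n j :
  j.+1%:R * 'C(n, j.+1)%:R = (n%:R - j%:R) * 'C(n, j)%:R :> R.
Proof.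
case: (leqP j n) => [le_jn | lt_nj].
  by rewrite -natrB // -!natrM mul_bin_left.
by rewrite !bin_small ?mulr0 // (ltn_trans lt_nj).
Qed.

(** The summand is the increment at n of the right-hand side, seen as a function
    of N. *)
Lemma sum_bin_sqr_rec (R : comNzRingType) N j :
  \sum_(0 <= n < N) (2 * (j.*2.+3)%:R * 'C(n, j.+1)%:R ^+ 2
                     - j.+1%:R * 'C(n, j)%:R ^+ 2)
  = (2 * N%:R - 3 * j.+1%:R) * 'C(N, j.+1)%:R ^+ 2 :> R.
Proof.
elim: N => [|N IH]; first by rewrite big_geq // bin0n expr0n mulr0.
rewrite big_nat_recr //= {}IH binS natrD.
have rel := natr_mul_bin_left R N j.
move: ('C(N, j.+1)%:R : R) ('C(N, j)%:R : R) rel => y x /eqP.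
rewrite -subr_eq0 => /eqP rel; apply/eqP; rewrite -subr_eq0.
have -> : (2 * N%:R - 3 * j.+1%:R) * y ^+ 2
  + (2 * (j.*2.+3)%:R * y ^+ 2 - j.+1%:R * x ^+ 2)
  - (2 * N.+1%:R - 3 * j.+1%:R) * (y + x) ^+ 2
  = (4 * y + 2 * x) * (j.+1%:R * y - (N%:R - j%:R) * x).
  by rewrite -mul2n; ring.
by rewrite rel mulr0.
Qed.

(** The n-th finite difference of m |-> 'C(m, k + n) is 'C(m, k). *)
Lemma altsum_bin_bin (R : comNzRingType) n m k :
  \sum_(0 <= j < n.+1) (-1) ^+ j * 'C(n, j)%:R * 'C(m + j, k + n)%:R
  = (-1) ^+ n * 'C(m, k)%:R :> R.
Proof.
elim: n m k => [|n IH] m k.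
  by rewrite big_nat1 expr0 bin0 !mul1r !addn0.
(* Pascal's rule splits the sum into the same sums for n at m and at m + 1. *)
have split_sum i :
    \sum_(0 <= j < i.+1) (-1) ^+ j * 'C(n.+1, j)%:R * 'C(m + j, k + n.+1)%:R
    = \sum_(0 <= j < i.+1) (-1) ^+ j * 'C(n, j)%:R * 'C(m + j, k + n.+1)%:R
      - \sum_(0 <= j < i) (-1) ^+ j * 'C(n, j)%:R * 'C(m.+1 + j, k + n.+1)%:R :> R.
  elim: i => [|i IHi].
    by rewrite !big_nat1 big_geq // subr0 !bin0.
  rewrite big_nat_recr // IHi //= [in RHS]big_nat_recr //=.
  rewrite [X in _ = _ - X]big_nat_recr //=.
  by rewrite binS natrD addSnnS exprS; ring.
rewrite split_sum big_nat_recr //= bin_small // mulr0 mul0r addr0.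
rewrite -addSnnS !IH binS natrD exprS; ring.
Qed.

End SumsInRings.

(** * Rings in which p^2 vanishes *)

(** Congruences modulo p^2 are stated as equalities in a commutative ring R where
    p^2 = 0 and where every integer prime to p is invertible. *)
Section ModSquare.
Local Open Scope ring_scope.
Variables (R : comUnitRingType) (p : nat).
Hypotheses (p_pr : prime p) (p_gt2 : (2 < p)%N).
Hypothesis p2_0 : p%:R ^+ 2 = 0 :> R.
Hypothesis unitR : forall n, coprime p n -> n%:R \is a @GRing.unit R.

Lemma unit_lt n : (0 < n < p)%N -> n%:R \is a @GRing.unit R.
Proof.
move=> /andP[n0 np]; apply: unitR; rewrite prime_coprime //.
by apply/negP => /(dvdn_leq n0); rewrite leqNgt np.
Qed.

Lemma dvdn_sqr0 n : (p %| n)%N -> n%:R ^+ 2 = 0 :> R.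
Proof. by move=> /dvdnP[m ->]; rewrite natrM exprMn p2_0 mulr0. Qed.

(** * The sum of the squared trinomials of the digits *)

Definition binsqr k : R := \sum_(0 <= n < p) 'C(n, k)%:R ^+ 2.
(** The sum of the squared trinomials of (j, k - j, n - k) over j <= k <= n < p. *)
Definition gsum k : R := 'C(k.*2, k)%:R * binsqr k.

Lemma gsumP k : (k < p)%N -> k.*2.+1%:R * gsum k = p%:R.
Proof.
elim: k => [|k IH] lt_kp.
  rewrite /gsum /binsqr bin0 !mul1r.
  under eq_bigr do rewrite bin0 expr1n.
  by rewrite sumr_const_nat subn0.
have := sum_bin_sqr_rec R p k; rewrite dvdn_sqr0 ?prime_dvd_bin // mulr0.
rewrite sumrB -!mulr_sumr -!/(binsqr _) => /eqP; rewrite subr_eq0 => /eqP rel.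
apply: (mulrI (@unit_lt k.+1 lt_kp)); rewrite -(IH (ltnW lt_kp)) /gsum.
have rc : k.+1%:R * 'C(k.+1.*2, k.+1)%:R = 2 * k.*2.+1%:R * 'C(k.*2, k)%:R :> R.
  by rewrite -!natrM central_bin_rec.
transitivity (k.+1.*2.+1%:R * (k.+1%:R * 'C(k.+1.*2, k.+1)%:R) * binsqr k.+1).
  by ring.
rewrite rc.
transitivity (k.*2.+1%:R * 'C(k.*2, k)%:R * (2 * k.*2.+3%:R * binsqr k.+1)).
  by rewrite doubleS; ring.
by rewrite rel; ring.
Qed.

Lemma gsum_reflect k : (k < p)%N -> k.*2.+1 <> p ->
  gsum k + gsum (p.-1 - k) = 0.
Proof.
move=> lt_kp neq.
have cop u : (0 < u)%N -> (u < p.*2)%N -> u != p -> coprime p u.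
  move=> u0 u2 up; rewrite prime_coprime //; apply/negP => /dvdnP[[|[|m]] e].
  - by rewrite e in u0.
  - by rewrite e mul1n eqxx in up.
  - by rewrite e in u2; nia.
have p_gt0 := prime_gt0 p_pr.
have uk : k.*2.+1%:R \is a @GRing.unit R.
  by apply/unitR/cop => //; [lia | apply/eqP].
have uk' : (p.-1 - k).*2.+1%:R \is a @GRing.unit R.
  by apply/unitR/cop => //; [lia | apply/eqP; lia].
apply: (mulrI uk); apply: (mulrI uk'); rewrite !mulr0.
rewrite mulrDr mulrDr gsumP // mulrCA gsumP; last by lia.
rewrite -mulrDl -natrD.
have -> : ((p.-1 - k).*2.+1 + k.*2.+1 = p * 2)%N by lia.
by rewrite natrM mulrAC -expr2 p2_0 mul0r.
Qed.

(** Modulo p = 2h + 1, the integer h + i + 1 is the opposite of h - i. *)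
Lemma bin_near h j : h.*2.+1 = p -> (j <= h)%N ->
  exists e : R, 'C(h + j, h)%:R = (-1) ^+ j * 'C(h, j)%:R + p%:R * e.
Proof.
move=> hp; elim: j => [|j IH] lejh.
  by exists 0; rewrite addn0 binn bin0 mulr0 addr0 mulr1.
have [e He] := IH (ltnW lejh).
have uj : j.+1%:R \is a @GRing.unit R by apply: unit_lt; lia.
exists (j.+1%:R^-1 * ((j%:R - h%:R) * e + 'C(h + j, h)%:R)).
apply: (mulrI uj).
have -> : j.+1%:R * 'C(h + j.+1, h)%:R = (h%:R + j%:R + 1) * 'C(h + j, h)%:R :> R.
  rewrite -natrD natr1 -!natrM; congr (_%:R).
  have := mul_bin_down (h + j).+1 h; rewrite /= addnS => ->.
  by congr (_ * _)%N; lia.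
rewrite mulrDr [X in _ = _ + X]mulrCA mulVKr // [X in _ = X + _]mulrCA.
rewrite natr_mul_bin_left exprS -hp.
have -> : (h%:R + j%:R + 1) * 'C(h + j, h)%:R
  = (j%:R - h%:R) * 'C(h + j, h)%:R + h.*2.+1%:R * 'C(h + j, h)%:R :> R.
  by rewrite -mul2n; ring.
rewrite {1}He -hp; ring.
Qed.

(** If d = c modulo p, then (d - c)^2 = 0, that is d^2 = 2 c d - c^2. *)
Lemma sqr_near (c e : R) : (c + p%:R * e) ^+ 2 = 2 * c * (c + p%:R * e) - c ^+ 2.
Proof.
have -> : (c + p%:R * e) ^+ 2
  = 2 * c * (c + p%:R * e) - c ^+ 2 + p%:R ^+ 2 * e ^+ 2 by ring.
by rewrite p2_0 mul0r addr0.
Qed.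

Lemma gsum_mid h : h.*2.+1 = p -> gsum h = 1.
Proof.
move=> hp; rewrite /gsum.
(* With d_j = 'C(h + j, h) and c_j = (-1)^j 'C(h, j), the sums of c_j d_j and
   of c_j^2 over j <= h are (-1)^h and 'C(2h, h). *)
have -> : binsqr h = 2 * (-1) ^+ h - 'C(h.*2, h)%:R.
  rewrite /binsqr (@big_cat_nat _ _ _ h) //=; last by lia.
  rewrite [X in X + _]big_nat big1 ?add0r; last first.
    by move=> i lt_ih; rewrite bin_small ?expr0n.
  rewrite -{1}[h]add0n big_addn.
  have -> : (p - h = h.+1)%N by lia.
  rewrite big_nat.
  under eq_bigr => j lejh.
    have [e He] := bin_near hp (lejh : (j <= h)%N).
    rewrite addnC He sqr_near -He; over.
  rewrite -big_nat sumrB.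
  congr (_ - _); last first.
    rewrite -sum_bin_sqr natr_sum; apply: eq_bigr => j _.
    by rewrite exprMn sqrr_sign mul1r natrX.
  have := altsum_bin_bin R h h 0; rewrite bin0 mulr1 => <-.
  by rewrite mulr_sumr; apply: eq_bigr => j _; rewrite add0n !mulrA.
have [e] := bin_near hp (leqnn h); rewrite addnn binn mulr1 => He.
have := sqr_near ((-1) ^+ h) e; rewrite -He sqrr_sign expr2 => E.
by rewrite mulrBr E; ring.
Qed.

Lemma sum_gsum : \sum_(0 <= k < p) gsum k = 1.
Proof.
have [h hp] : exists h, h.*2.+1 = p.
  exists p./2; have [|podd] := even_prime p_pr; first by lia.
  by have := odd_double_half p; rewrite podd.
have u2 : 2 \is a @GRing.unit R by apply: unit_lt.
apply: (mulrI u2); rewrite mulr1.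
have -> : 2 * (\sum_(0 <= k < p) gsum k) = \sum_(0 <= k < p) (gsum k + gsum (p.-1 - k)).
  rewrite big_split /= mulr_natl mulr2n; congr (_ + _).
  by rewrite big_nat_rev; apply: eq_bigr => i _; congr gsum; lia.
have lt_hp : (h < p)%N by lia.
rewrite big_mkord (bigD1 (Ordinal lt_hp)) //= big1 ?addr0.
  by have -> : (p.-1 - h = h)%N; [lia | rewrite gsum_mid].
move=> k /eqP neq; apply: gsum_reflect => // E; apply: neq; apply: val_inj.
by rewrite /=; lia.
Qed.

(** * Harmonic numbers and factorials *)

(** The harmonic number H_n in R. It is meaningful for n < p only: an index j that
    is a multiple of p is not invertible, and its summand is then j itself. *)
Definition harm n : R := \sum_(1 <= j < n.+1) j%:R^-1.

Lemma harmS n : harm n.+1 = harm n + n.+1%:R^-1.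
Proof. by rewrite /harm big_nat_recr. Qed.

Lemma p_inv_opp i j : (0 < i)%N -> (0 < j)%N -> (i + j)%N = p ->
  p%:R * i%:R^-1 = - (p%:R * j%:R^-1) :> R.
Proof.
move=> i0 j0 ijp.
have ui : i%:R \is a @GRing.unit R by apply: unit_lt; lia.
have uj : j%:R \is a @GRing.unit R by apply: unit_lt; lia.
apply: (mulrI ui); apply: (mulrI uj); apply/eqP; rewrite -subr_eq0; apply/eqP.
rewrite [i%:R * _]mulrCA mulrV // mulr1 !mulrN opprK.
rewrite [j%:R * (i%:R * _)]mulrCA [j%:R * (p%:R * _)]mulrCA mulrV // mulr1.
by rewrite -mulrDl addrC -natrD ijp -expr2.
Qed.

Lemma p_harm_last : p%:R * harm p.-1 = 0.
Proof.
have p_gt0 := prime_gt0 p_pr.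
have u2 : 2 \is a @GRing.unit R by apply: unit_lt.
apply: (mulrI u2); rewrite mulr0 mulr_natl mulr2n /harm prednK // mulr_sumr.
rewrite {1}big_nat_rev /= -big_split /= big_nat big1 // => j /andP[j0 jp].
by rewrite (@p_inv_opp _ j) ?addNr //; lia.
Qed.

Lemma p_harm_rev k : (k < p)%N -> p%:R * harm (p.-1 - k) = p%:R * harm k.
Proof.
elim: k => [|k IH] lt_kp.
  by rewrite subn0 p_harm_last /harm big_geq ?mulr0.
rewrite harmS mulrDr -IH 1?ltnW //.
have -> : (p.-1 - k = (p.-1 - k.+1).+1)%N by lia.
by rewrite harmS mulrDr (@p_inv_opp _ k.+1) ?subrK //; lia.
Qed.

Lemma prod_block a b : (b < p)%N ->
  (\prod_(1 <= j < b.+1) (a * p + j))%:R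
  = b`!%:R * (1 + p%:R * (a%:R * harm b)) :> R.
Proof.
elim: b => [|b IH] lt_bp.
  by rewrite /harm !big_geq // !mulr0 addr0 mulr1.
rewrite big_nat_recr //= natrM IH 1?ltnW // harmS factS natrM.
have ub := unit_lt (lt_bp : (0 < b.+1 < p)%N).
rewrite natrD natrM; have := mulrV ub.
move: (b.+1%:R : R) (b.+1%:R^-1 : R) (b`!%:R : R) (harm b) (a%:R : R).
move=> u v f h x uv.
transitivity (f * u * (1 + p%:R * x * h) + f * p%:R * x * (u * v)
              + p%:R ^+ 2 * (f * x ^+ 2 * h)); first by rewrite uv; ring.
by rewrite p2_0 mul0r addr0; ring.
Qed.

Lemma pfreeE a b : (b < p)%N ->
  (pfree p a b)%:R
  = (p.-1)`!%:R ^+ a * b`!%:R * (1 + p%:R * (a%:R * harm b)) :> R.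
Proof.
move=> lt_bp; rewrite natrM prod_block // mulrA; congr (_ * _ * _).
have p_gt0 := prime_gt0 p_pr.
elim: a => [|a IH]; first by rewrite big_geq.
rewrite big_nat_recr //= natrM IH exprSr; congr (_ * _).
rewrite -{1}(prednK p_gt0) prod_block ?prednK //.
by rewrite mulrCA p_harm_last mulr0 addr0 mulr1.
Qed.

Lemma unit_fact n : (n < p)%N -> n`!%:R \is a @GRing.unit R.
Proof.
elim: n => [|n IH] lt_np; first exact: unitr1.
by rewrite factS natrM unitrM IH 1?ltnW // andbT unit_lt.
Qed.

(** * Trinomials modulo p^2 *)

Lemma trinomial_block a1 a2 a3 b1 b2 b3 : (b1 + b2 + b3 < p)%N ->
  (trinomial (a1 * p + b1) (a2 * p + b2) (a3 * p + b3))%:R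
  = (trinomial a1 a2 a3)%:R * (trinomial b1 b2 b3)%:R
    * (1 + p%:R * (a1%:R * (harm (b1 + b2 + b3) - harm b1)
                   + a2%:R * (harm (b1 + b2 + b3) - harm b2)
                   + a3%:R * (harm (b1 + b2 + b3) - harm b3))) :> R.
Proof.
move=> lt_Bp.
have lt1 : (b1 < p)%N by lia.
have lt2 : (b2 < p)%N by lia.
have lt3 : (b3 < p)%N by lia.
have : (trinomial (a1 * p + b1) (a2 * p + b2) (a3 * p + b3))%:R
  * ((pfree p a1 b1)%:R * (pfree p a2 b2)%:R * (pfree p a3 b3)%:R)
  = (trinomial a1 a2 a3)%:R * (pfree p (a1 + a2 + a3) (b1 + b2 + b3))%:R :> R.
  by rewrite -!natrM trinomial_pfree // prime_gt0.
have uw : (p.-1)`!%:R \is a @GRing.unit R.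
  by apply: unit_fact; rewrite prednK // prime_gt0.
move: (unit_fact lt1) (unit_fact lt2) (unit_fact lt3).
rewrite !pfreeE // -(trinomialK b1 b2 b3) !natrM !natrD.
move: (trinomial (_ + _) _ _)%:R => t.
move: (trinomial a1 a2 a3)%:R (trinomial b1 b2 b3)%:R => ta tb.
move: (b1`!%:R) (b2`!%:R) (b3`!%:R) => f1 f2 f3 u1 u2 u3.
move: (p.-1)`!%:R uw => w uw.
move: (harm (b1 + b2 + b3)) (harm b1) (harm b2) (harm b3) => hB h1 h2 h3.
move: (a1%:R) (a2%:R) (a3%:R) => x1 x2 x3 e.
have u : w ^+ (a1 + a2 + a3) * (f1 * f2 * f3) \is a GRing.unit.
  by rewrite !unitrM unitrX // u1 u2 u3.
(* As p^2 = 0, the factor 1 + p x has inverse 1 - p x. *)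
have inv1 (x : R) : (1 + p%:R * x) * (1 - p%:R * x) = 1.
  transitivity (1 - p%:R ^+ 2 * x ^+ 2); first by ring.
  by rewrite p2_0 mul0r subr0.
have {}e : t * ((1 + p%:R * (x1 * h1)) * (1 + p%:R * (x2 * h2))
                * (1 + p%:R * (x3 * h3)))
  = ta * tb * (1 + p%:R * ((x1 + x2 + x3) * hB)).
  apply: (mulrI u); rewrite !exprD.
  transitivity (ta * (w ^+ (a1 + a2 + a3) * (tb * (f1 * f2 * f3)) *
      (1 + p%:R * ((x1 + x2 + x3) * hB)))); last by rewrite !exprD; ring.
  by rewrite -e; ring.
transitivity (t * ((1 + p%:R * (x1 * h1)) * (1 - p%:R * (x1 * h1)))
  * ((1 + p%:R * (x2 * h2)) * (1 - p%:R * (x2 * h2)))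
  * ((1 + p%:R * (x3 * h3)) * (1 - p%:R * (x3 * h3)))).
  by rewrite !inv1 !mulr1.
transitivity (t * ((1 + p%:R * (x1 * h1)) * (1 + p%:R * (x2 * h2))
                * (1 + p%:R * (x3 * h3))) * ((1 - p%:R * (x1 * h1))
  * (1 - p%:R * (x2 * h2)) * (1 - p%:R * (x3 * h3)))).
  by ring.
have p2M (x y : R) : (1 + p%:R * x) * (1 + p%:R * y) = 1 + p%:R * (x + y).
  transitivity (1 + p%:R * (x + y) + p%:R ^+ 2 * (x * y)); first by ring.
  by rewrite p2_0 mul0r addr0.
by rewrite e -!mulrA -!mulrN !p2M !mulrA; congr (_ * (1 + _ * _)); ring.
Qed.

Lemma trinomial_sqr0 a1 a2 a3 b1 b2 b3 :
  (b1 < p)%N -> (b2 < p)%N -> (b3 < p)%N -> (p <= b1 + b2 + b3)%N ->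
  (trinomial (a1 * p + b1) (a2 * p + b2) (a3 * p + b3))%:R ^+ 2 = 0 :> R.
Proof. by move=> *; apply/dvdn_sqr0/dvdn_trinomial. Qed.

(** A form of Wilson's theorem: up to sign, k! (p - 1 - k)! = (p - 1)! modulo p. *)
Lemma p_fact_rev k : (k < p)%N ->
  p%:R * (k`!%:R * (p.-1 - k)`!%:R) ^+ 2 = p%:R * (p.-1)`!%:R ^+ 2 :> R.
Proof.
elim: k => [|k IH] lt_kp; first by rewrite subn0 mul1r.
rewrite -IH 1?ltnW //.
have -> : (p.-1 - k = (p.-1 - k.+1).+1)%N by lia.
have : (p.-1 - k.+1).+1%:R + k.+1%:R = p%:R :> R.
  by rewrite -natrD; congr _%:R; lia.
rewrite !factS !natrM.
move: (p.-1 - k.+1)%N => m e; apply/eqP; rewrite -subr_eq0; apply/eqP.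
move: (m`!%:R : R) (k`!%:R : R) (m.+1%:R : R) (k.+1%:R : R) e => x y u v e.
transitivity (p%:R * (u + v) * (v - u) * (x * y) ^+ 2); first by ring.
by rewrite e -expr2 p2_0 !mul0r.
Qed.

(** Modulo p, the square of the trinomial is a constant over a product symmetric
    in the four integers b1, b2, b3 and p - 1 - (b1 + b2 + b3). *)
Lemma p_trinomial_fact b1 b2 b3 : (b1 + b2 + b3 < p)%N ->
  p%:R * (trinomial b1 b2 b3)%:R ^+ 2
    * (b1`! * b2`! * b3`! * (p.-1 - (b1 + b2 + b3))`!)%:R ^+ 2
  = p%:R * (p.-1)`!%:R ^+ 2 :> R.
Proof.
move=> lt_Bp; rewrite -(p_fact_rev lt_Bp) -trinomialK !natrM; ring.
Qed.

(** Exchanging b1 with p - 1 - (b1 + b2 + b3) does not change the square of the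
    trinomial modulo p. *)
Lemma p_trinomial_rev b1 b2 b3 : (b1 + b2 + b3 < p)%N ->
  p%:R * (trinomial (p.-1 - (b1 + b2 + b3)) b2 b3)%:R ^+ 2
  = p%:R * (trinomial b1 b2 b3)%:R ^+ 2 :> R.
Proof.
move=> lt_Bp.
have lt_B'p : (p.-1 - (b1 + b2 + b3) + b2 + b3 < p)%N by lia.
have := p_trinomial_fact lt_B'p; rewrite -(p_trinomial_fact lt_Bp).
have -> : (p.-1 - (p.-1 - (b1 + b2 + b3) + b2 + b3) = b1)%N by lia.
have -> : ((p.-1 - (b1 + b2 + b3))`! * b2`! * b3`! * b1`!
  = b1`! * b2`! * b3`! * (p.-1 - (b1 + b2 + b3))`!)%N by ring.
by apply: mulIr; rewrite unitrX // !natrM !unitrM !unit_fact //; lia.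
Qed.

(** * Sums over the digits *)

Lemma sum_trinomial_harm b2 b3 : (b2 < p)%N -> (b3 < p)%N ->
  \sum_(0 <= b1 < p) (trinomial b1 b2 b3)%:R ^+ 2
     * (p%:R * (harm (b1 + b2 + b3) - harm b1)) = 0.
Proof.
move=> lt2 lt3.
have u2 : 2 \is a @GRing.unit R by apply: unit_lt.
pose q b1 := (trinomial b1 b2 b3)%:R ^+ 2
     * (p%:R * (harm (b1 + b2 + b3) - harm b1)).
have q0 b1 : (b1 < p)%N -> (p <= b1 + b2 + b3)%N -> q b1 = 0.
  by move=> lt1 geB; rewrite /q (@trinomial_sqr0 0 0 0) ?mul0r.
rewrite -/(q _) (@big_cat_nat _ _ _ (p - (b2 + b3))) ?leq_subr //=.
rewrite [X in _ + X]big_nat [X in _ + X]big1 ?addr0; last first.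
  by move=> b1 /andP[ge1 lt1]; apply: q0 => //; lia.
(* The reflection of the summation range turns the summand into its opposite. *)
apply: (mulrI u2); rewrite mulr0 mulr_natl mulr2n {1}big_nat_rev.
rewrite -big_split /= big_nat big1 // => b1 lt1.
have lt_Bp : (b1 + b2 + b3 < p)%N by lia.
have -> : (0 + (p - (b2 + b3)) - b1.+1 = p.-1 - (b1 + b2 + b3))%N by lia.
rewrite /q mulrA [_ * p%:R]mulrC p_trinomial_rev //.
have -> : (p.-1 - (b1 + b2 + b3) + b2 + b3 = p.-1 - b1)%N by lia.
rewrite -[X in X + _]mulrA [p%:R * (_ * _)]mulrCA -mulrDr mulrBr.
rewrite !p_harm_rev //; last by lia.
by rewrite -mulrBr -mulrDr addrA subrK subrr !mulr0.
Qed.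

Lemma sum_trinomial_box1 :
  \sum_(0 <= b1 < p) \sum_(0 <= b2 < p) \sum_(0 <= b3 < p)
    (trinomial b1 b2 b3)%:R ^+ 2 = 1 :> R.
Proof.
(* With c = b1 + b2 and n = c + b3, the square of the trinomial is the product
   of 'C(c, b1)^2 and 'C(n, c)^2; triples with p <= n contribute 0. *)
pose g c n : R := if (n < p)%N then 'C(n, c)%:R ^+ 2 else 0.
pose f j k : R := 'C(k, j)%:R ^+ 2 * \sum_(0 <= n < p) g k n.
have gE k : \sum_(0 <= n < p) g k n = binsqr k.
  rewrite big_nat [RHS]big_nat; apply: eq_bigr => n /andP[_ lt_np].
  by rewrite /g lt_np.
transitivity (\sum_(0 <= b1 < p) \sum_(0 <= b2 < p) f b1 (b2 + b1)%N).
  rewrite big_nat [RHS]big_nat; apply: eq_bigr => b1 lt1.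
  rewrite big_nat [RHS]big_nat; apply: eq_bigr => b2 lt2.
  rewrite /f [(b2 + b1)%N]addnC -(@sum_nat_shift _ (g (b1 + b2)%N) (b1 + b2) p); first last.
  - by move=> k le_pk; rewrite /g ltnNge le_pk.
  - by move=> k lt_k; rewrite /g bin_small // expr0n /=; case: ifP.
  rewrite mulr_sumr big_nat [RHS]big_nat; apply: eq_bigr => b3 lt3.
  rewrite /g; case: ltnP => [lt_B|ge_B].
    by rewrite trinomial_bin natrM exprMn mulrC.
  by rewrite mulr0 (@trinomial_sqr0 0 0 0) //; lia.
rewrite -sum_gsum.
transitivity (\sum_(0 <= b1 < p) \sum_(0 <= k < p) f b1 k).
  apply: eq_bigr => b1 _; apply: sum_nat_shift => k lek.
    by rewrite /f bin_small // expr0n mul0r.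
  rewrite /f [X in _ * X]big_nat [X in _ * X]big1 ?mulr0 // => n /andP[_ lt_n].
  by rewrite /g lt_n bin_small ?expr0n // (leq_trans lt_n).
rewrite exchange_big_nat /= big_nat [RHS]big_nat.
apply: eq_bigr => k lt_k; rewrite /f -mulr_suml gE /gsum; congr (_ * _).
rewrite -sum_bin_sqr natr_sum (@big_cat_nat _ _ _ k.+1) //=.
rewrite [X in _ + X]big_nat [X in _ + X]big1 ?addr0.
  by apply: eq_bigr => i _; rewrite natrX.
by move=> j /andP[lt_kj _]; rewrite bin_small ?expr0n.
Qed.

Lemma sum_trinomial_box a1 a2 a3 :
  \sum_(0 <= b1 < p) \sum_(0 <= b2 < p) \sum_(0 <= b3 < p)
    (trinomial (a1 * p + b1) (a2 * p + b2) (a3 * p + b3))%:R ^+ 2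
  = (trinomial a1 a2 a3)%:R ^+ 2 :> R.
Proof.
pose q b1 b2 b3 b : R := (trinomial b1 b2 b3)%:R ^+ 2
     * (p%:R * (harm (b1 + b2 + b3) - harm b)).
pose ta : R := (trinomial a1 a2 a3)%:R ^+ 2.
transitivity (\sum_(0 <= b1 < p) \sum_(0 <= b2 < p) \sum_(0 <= b3 < p)
  (ta * (trinomial b1 b2 b3)%:R ^+ 2 + ta * 2 * a1%:R * q b1 b2 b3 b1
   + ta * 2 * a2%:R * q b1 b2 b3 b2 + ta * 2 * a3%:R * q b1 b2 b3 b3)).
  rewrite big_nat [RHS]big_nat; apply: eq_bigr => b1 lt1.
  rewrite big_nat [RHS]big_nat; apply: eq_bigr => b2 lt2.
  rewrite big_nat [RHS]big_nat; apply: eq_bigr => b3 lt3.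
  rewrite /q /ta; case: (ltnP (b1 + b2 + b3) p) => [lt_B|ge_B]; last first.
    rewrite trinomial_sqr0 // (@trinomial_sqr0 0 0 0 b1 b2 b3) //.
    by rewrite !mul0r !mulr0 !addr0.
  rewrite trinomial_block // !exprMn.
  move: (harm _ - _) (harm _ - _) (harm _ - _) => x1 x2 x3.
  have sq1 (x : R) : (1 + p%:R * x) ^+ 2 = 1 + p%:R * 2 * x.
    transitivity (1 + p%:R * 2 * x + p%:R ^+ 2 * x ^+ 2); first by ring.
    by rewrite p2_0 mul0r addr0.
  by rewrite sq1; ring.
have z3 b1 b2 : (b1 < p)%N -> (b2 < p)%N ->
    \sum_(0 <= b3 < p) q b1 b2 b3 b3 = 0.
  move=> lt1 lt2; rewrite -[RHS](@sum_trinomial_harm b2 b1) //; apply: eq_bigr => b3 _.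
  by rewrite /q trinomialC13; congr (_ * (_ * (harm _ - _))); ring.
have z2 b1 b3 : (b1 < p)%N -> (b3 < p)%N ->
    \sum_(0 <= b2 < p) q b1 b2 b3 b2 = 0.
  move=> lt1 lt3; rewrite -[RHS](@sum_trinomial_harm b1 b3) //; apply: eq_bigr => b2 _.
  by rewrite /q trinomialC12; congr (_ * (_ * (harm _ - _))); ring.
have s3 : \sum_(0 <= b1 < p) \sum_(0 <= b2 < p) \sum_(0 <= b3 < p)
    q b1 b2 b3 b3 = 0.
  rewrite big_nat big1 // => b1 lt1; rewrite big_nat big1 // => b2 lt2.
  exact: z3.
have s2 : \sum_(0 <= b1 < p) \sum_(0 <= b2 < p) \sum_(0 <= b3 < p)
    q b1 b2 b3 b2 = 0.
  rewrite big_nat big1 // => b1 lt1; rewrite exchange_big_nat big_nat big1 //=.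
  by move=> b3 lt3; apply: z2.
have s1 : \sum_(0 <= b1 < p) \sum_(0 <= b2 < p) \sum_(0 <= b3 < p)
    q b1 b2 b3 b1 = 0.
  rewrite exchange_big_nat big_nat big1 //= => b2 lt2.
  rewrite exchange_big_nat big_nat big1 //= => b3 lt3.
  exact: sum_trinomial_harm.
have sum3D (f g : nat -> nat -> nat -> R) :
    \sum_(0 <= b1 < p) \sum_(0 <= b2 < p) \sum_(0 <= b3 < p)
      (f b1 b2 b3 + g b1 b2 b3)
    = \sum_(0 <= b1 < p) \sum_(0 <= b2 < p) \sum_(0 <= b3 < p) f b1 b2 b3
      + \sum_(0 <= b1 < p) \sum_(0 <= b2 < p) \sum_(0 <= b3 < p) g b1 b2 b3.
  rewrite -big_split; apply: eq_bigr => b1 _.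
  by rewrite -big_split; apply: eq_bigr => b2 _; rewrite -big_split.
have sum3Z (c : R) (f : nat -> nat -> nat -> R) :
    \sum_(0 <= b1 < p) \sum_(0 <= b2 < p) \sum_(0 <= b3 < p) c * f b1 b2 b3
    = c * \sum_(0 <= b1 < p) \sum_(0 <= b2 < p) \sum_(0 <= b3 < p) f b1 b2 b3.
  rewrite mulr_sumr; apply: eq_bigr => b1 _.
  by rewrite mulr_sumr; apply: eq_bigr => b2 _; rewrite mulr_sumr.
by rewrite !sum3D !sum3Z s1 s2 s3 sum_trinomial_box1 !mulr0 !addr0 mulr1.
Qed.

End ModSquare.

(** * The congruence *)

Theorem theorem3 (p r s t : nat) (hp : prime p) (hp2 : 2 < p)
    (hr : 0 < r) (hs : 0 < s) (ht : 0 < t) :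
  \sum_(0 <= m1 < r * p) \sum_(0 <= m2 < s * p) \sum_(0 <= m3 < t * p)
     trinomial m1 m2 m3 ^ 2
  = \sum_(0 <= m1 < r) \sum_(0 <= m2 < s) \sum_(0 <= m3 < t)
     trinomial m1 m2 m3 ^ 2 %[mod p ^ 2].
Proof.
have p2_gt1 : 1 < p ^ 2 by rewrite (ltn_exp2l 0) ?prime_gt1.
rewrite -!(val_Zp_nat p2_gt1) !natr_sum; congr (nat_of_ord _).
have natr_sum3 n1 n2 n3 :
    (\sum_(0 <= m1 < n1) (\sum_(0 <= m2 < n2) \sum_(0 <= m3 < n3)
       trinomial m1 m2 m3 ^ 2)%:R
     = \sum_(0 <= m1 < n1) \sum_(0 <= m2 < n2) \sum_(0 <= m3 < n3)
       (trinomial m1 m2 m3)%:R ^+ 2 :> 'Z_(p ^ 2))%R.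
  apply: eq_bigr => m1 _; rewrite natr_sum; apply: eq_bigr => m2 _.
  by rewrite natr_sum; apply: eq_bigr => m3 _; rewrite natrX.
have p2_0 : (p%:R ^+ 2 = 0 :> 'Z_(p ^ 2))%R.
  by rewrite -natrX; apply: val_inj; rewrite /= val_Zp_nat // modnn.
have unitR n : coprime p n -> (n%:R \is a @GRing.unit 'Z_(p ^ 2))%R.
  by move=> cop; rewrite unitZpE // coprimeXl.
rewrite !natr_sum3 sum_nat_block; apply: eq_bigr => a1 _.
under eq_bigr do rewrite sum_nat_block.
rewrite exchange_big_nat /=; apply: eq_bigr => a2 _.
under eq_bigr do under eq_bigr do rewrite sum_nat_block.
under eq_bigr do rewrite exchange_big_nat.
rewrite exchange_big_nat /=; apply: eq_bigr => a3 _.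
exact: sum_trinomial_box.
Qed.
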